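(* Let $\mathcal{D}$ and $\mathcal{D}'$ be division rings with involutions $x\mapsto\overline{x}$ and $x\mapsto\overline{x}'$ respectively, each satisfying restrictions (R1) and (R2) below. Let $n,n'\ge 2$ be integers. If $\varphi:\mathcal{H}_n(\mathcal{D})\to\mathcal{H}_{n'}(\mathcal{D}')$ is a surjection such that for all $A,B\in\mathcal{H}_n(\mathcal{D})$, $$\operatorname{rank}(A-B)=n\iff\operatorname{rank}(A^{\varphi}-B^{\varphi})=n',$$ then $\varphi$ is bijective, both $\varphi$ and $\varphi^{-1}$ preserve adjacency of Hermitian matrices (two matrices $A,B$ being adjacent iff $\operatorname{rank}(A-B)=1$), and $n=n'$. Restrictions for a division ring $\mathcal{E}$ with involution whose fixed-element set is $\mathcal{F}$: (R1) $|\mathcal{F}\cap Z(\mathcal{E})|>3$, where $Z(\mathcal{E})$ is the centre of $\mathcal{E}$; (R2) if the involution is the identity map (so $\mathcal{E}=\mathcal{F}$ is a field), then $\operatorname{char}\mathcal{F}\neq 2$.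
   Context: An involution of a division ring is an anti-automorphism whose square is the identity. $\mathcal{H}_n(\mathcal{D})$ is the set of $n\times n$ matrices $M$ over $\mathcal{D}$ with $\overline{M}{}^t=M$ (entrywise involution, then transpose), and similarly $\mathcal{H}_{n'}(\mathcal{D}')$ with respect to the involution of $\mathcal{D}'$. Rank means left row rank. $A^{\varphi}$ denotes the image of $A$. *)

(* Defs.v *)
From mathcomp Require Import all_boot all_order all_algebra.
From mathcomp Require Import boolp classical_sets functions cardinality.

Set Implicit Arguments.
Unset Strict Implicit.
Unset Printing Implicit Defensive.

Import GRing.Theory.

Local Open Scope classical_set_scope.
Local Open Scope ring_scope.

(* Multiplication of a unitRingType need not be commutative. *)
Definition division_ring (D : unitRingType) : Prop :=
  forall x : D, x != 0 -> x \is a GRing.unit.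

Definition anti_automorphism (D : unitRingType) (s : D -> D) : Prop :=
  [/\ bijective s,
      {morph s : x y / x + y},
      s 1 = 1
    & {morph s : x y / x * y >-> y * x}].

Definition ring_involution (D : unitRingType) (s : D -> D) : Prop :=
  anti_automorphism s /\ (forall x, s (s x) = x).

Definition fixed_elements (D : unitRingType) (s : D -> D) : set D :=
  [set x | s x = x].

Definition ring_center (D : unitRingType) : set D :=
  [set x | forall y, x * y = y * x].
Arguments ring_center : clear implicits.

(* The cardinality bound is cardinal-theoretic: the set may be infinite. *)
Definition restriction_R1 (D : unitRingType) (s : D -> D) : Prop :=
  ~ ((fixed_elements s `&` ring_center D) #<= `I_3)%card.

Definition restriction_R2 (D : unitRingType) (s : D -> D) : Prop :=
  (forall x, s x = x) -> 2%N \notin [pchar D].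

Definition is_hermitian (D : unitRingType) (s : D -> D) (n : nat) :
    pred 'M[D]_n :=
  fun M => (map_mx s M)^T == M.

Definition hermitian_mx (D : unitRingType) (s : D -> D) (n : nat) : Type :=
  {M : 'M[D]_n | is_hermitian s M}.

(* [*:] multiplies scalars on the left. *)
Definition left_independent_rows (D : unitRingType) (m n : nat)
    (A : 'M[D]_(m, n)) (S : {set 'I_m}) : Prop :=
  forall c : 'I_m -> D,
    \sum_(i in S) c i *: row i A = 0 -> forall i, i \in S -> c i = 0.

(* [mxrank] requires a commutative field, so the left row rank is defined
   here, as the maximal number of left linearly independent rows. *)
Definition left_row_rank (D : unitRingType) (m n : nat)
    (A : 'M[D]_(m, n)) : nat :=
  \max_(S : {set 'I_m} | `[< left_independent_rows A S >]) #|S|.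

Definition adjacent (D : unitRingType) (s : D -> D) (n : nat)
    (A B : hermitian_mx s n) : Prop :=
  left_row_rank (val A - val B) = 1%N.

Definition preserves_adjacency (D D' : unitRingType) (s : D -> D)
    (s' : D' -> D') (n n' : nat)
    (f : hermitian_mx s n -> hermitian_mx s' n') : Prop :=
  forall A B, adjacent A B -> adjacent (f A) (f B).

(* Main.v *)
Require Import Defs.
From mathcomp Require Import boolp classical_sets cardinality.
From mathcomp Require Import all_boot all_order all_algebra perm.

(** Call two Hermitian matrices opposite when their difference has full rank.
    Adjacency can be recovered from opposition: distinct A, B are adjacent iff
    some P other than A, B satisfies: every X opposite to P is opposite to A
    or to B.  If A - B has rank one, P = B + t (A - B) with t central
    symmetric, t <> 0, 1, works, since X - P being regular leaves at most one
    singular point on the line through A and B.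

    Conversely, translate P to 0 and write a, b, g for the Hermitian forms of
    A, B, A - B.  If u, w satisfy g(u, w) = 0 and the matrix
    [[a(u, u), a(u, w)], [b(w, u), b(w, w)]] is regular, then there is a regular
    Hermitian X with u X = u A and w X = w B, so X - A and X - B are singular.
    As A - B has rank at least two, there are g-orthogonal e, f that are not
    g-isotropic.  If no pair (u, w) as above exists, then either a or b vanishes
    on the span of e and f, and moving e and f propagates this to A = 0 or
    B = 0.  The equality of dimensions follows by mapping the path of diagonal
    idempotents from 0 to 1. *)

Set Implicit Arguments.
Unset Strict Implicit.
Unset Printing Implicit Defensive.

Import GRing.Theory.

Local Open Scope ring_scope.

(** Full rank is handled in this form because determinants make no sense over a noncommutative ring;
    for square matrices it amounts to invertibility, see [row_regular_inv]. *)
Definition row_regular (D : unitRingType) (m n : nat) (M : 'M[D]_(m, n)) :=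
  forall x : 'rV_m, x *m M = 0 -> x = 0.

(** * Linear algebra over a division ring *)

Section DivisionRing.

Variables (D : unitRingType) (divD : division_ring D).

Lemma div_mulVr (x : D) : x != 0 -> x^-1 * x = 1.
Proof. by move=> /divD; apply: mulVr. Qed.

Lemma div_mulrV (x : D) : x != 0 -> x * x^-1 = 1.
Proof. by move=> /divD; apply: mulrV. Qed.

Lemma div_invr_neq0 (x : D) : x != 0 -> x^-1 != 0.
Proof.
move=> x0; apply/eqP => xV0; have := div_mulVr x0.
by rewrite xV0 mul0r => /esym/eqP; rewrite oner_eq0.
Qed.

Lemma div_mulf_eq0 (x y : D) : x * y = 0 -> x = 0 \/ y = 0.
Proof.
move=> xy0; have [->|x0] := eqVneq x 0; [by left | right].
by rewrite -[y]mul1r -(div_mulVr x0) -mulrA xy0 mulr0.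
Qed.

Lemma div_mulf_neq0 (x y : D) : x != 0 -> y != 0 -> x * y != 0.
Proof. by move=> x0 y0; apply/eqP => /div_mulf_eq0 [] /eqP; apply/negP. Qed.

(** The only set of [m] rows is the set of all rows, so the maximum reaches [m] exactly when all
    rows together are independent. *)
Lemma left_row_rank_full (m n : nat) (M : 'M[D]_(m, n)) :
  left_row_rank M = m <-> row_regular M.
Proof.
have indepT : left_independent_rows M setT <-> row_regular M.
  split=> [indM x xM0|regM c cM0 i _].
    apply/rowP => i; rewrite mxE; apply: (indM (x 0)); last by rewrite inE.
    rewrite -[RHS]xM0 mulmx_sum_row; apply: eq_bigl => j; by rewrite inE.
  have /rowP/(_ i) : \row_j c j = 0.
    apply: regM; rewrite mulmx_sum_row -[RHS]cM0.
    by apply: eq_big => [j|j _]; rewrite ?inE ?mxE.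
  by rewrite !mxE.
rewrite -indepT; split => [rkM|indM].
  have [|S /= indS rkS] := @eq_bigmax_cond _
    (fun S : {set 'I_m} => `[< left_independent_rows M S >]) (fun S => #|S|).
    (* The empty set of rows is independent, so the maximum is attained. *)
    apply/card_gt0P; exists set0; apply/asboolP => c _ i.
    by rewrite inE.
  have <- : S = setT.
    apply/eqP; rewrite eqEcard subsetT cardsT card_ord /=.
    by rewrite -[leqLHS]rkM /left_row_rank rkS.
  exact/asboolP.
apply/eqP; rewrite eqn_leq; apply/andP; split.
  by apply/bigmax_leqP => S _; rewrite -[leqRHS]card_ord max_card.
rewrite -[leqLHS](card_ord m) -cardsT.
by apply: leq_bigmax_cond; apply/asboolP.
Qed.

(** In rank one, a nonzero row [i] spans every other row, and the multipliers form [c]. Conversely,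
    any two rows of [c *m r] are left multiples of [r], hence dependent. *)
Lemma left_row_rank1P (m n : nat) (M : 'M[D]_(m, n)) :
  left_row_rank M = 1%N <->
  M <> 0 /\ exists (c : 'cV_m) (r : 'rV_n), M = c *m r.
Proof.
have ind1 i : row i M != 0 -> left_independent_rows M [set i].
  move=> Mi0 c; rewrite big_set1 => ci0 j; rewrite inE => /eqP ->.
  apply/eqP; apply: contra_neqT Mi0 => c0.
  by rewrite -[row i M]scale1r -(div_mulVr c0) -scalerA ci0 scaler0.
have nzrow : M <> 0 -> exists i, row i M != 0.
  move=> M0; apply: contrapT => nz; apply: M0; apply/row_matrixP => i.
  rewrite row0; apply/eqP; apply: contrapT => /negP Mi0; apply: nz.
  by exists i.
split=> [rkM|[M0 [c [r defM]]]].
  have M0 : M <> 0.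
    move=> M0; suff : (left_row_rank M <= 0)%N by rewrite rkM.
    apply/bigmax_leqP => S /asboolP indS; rewrite leqn0 cards_eq0.
    apply/eqP/setP => i; rewrite inE; apply/negP => Si.
    suff /eqP : (1 : D) = 0 by rewrite oner_eq0.
    apply: (indS (fun=> 1)) Si; rewrite big1 // => j _.
    by rewrite M0 row0 scaler0.
  split=> //; have [i Mi0] := nzrow M0.
  suff rowZ j : exists a, row j M = a *: row i M.
    exists (\col_j sval (cid (rowZ j))), (row i M); apply/row_matrixP => j.
    rewrite (svalP (cid (rowZ j))) row_mul; apply/rowP => k.
    by rewrite !mxE big_ord1 !mxE.
  have [->|jNi] := eqVneq j i; first by exists 1; rewrite scale1r.
  have /existsNP[c] : ~ left_independent_rows M [set i; j].
    move=> ind2; suff : (2 <= left_row_rank M)%N by rewrite rkM.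
    have <- : #|[set i; j]| = 2%N by rewrite cards2 eq_sym jNi.
    by apply: leq_bigmax_cond; apply/asboolP.
  rewrite big_setU1 ?inE 1?eq_sym // big_set1 /= => /not_implyP[cM0 cn0].
  have [cj0|cj0] := eqVneq (c j) 0.
    case: cn0 => k; rewrite !inE => /orP[]/eqP-> //.
    apply/eqP; apply: contra_neqT Mi0 => ci0.
    move: cM0; rewrite cj0 scale0r addr0 => ciM.
    by rewrite -[row i M]scale1r -(div_mulVr ci0) -scalerA ciM scaler0.
  exists (- ((c j)^-1 * c i)).
  rewrite scaleNr -scalerA; move/eqP: cM0; rewrite addr_eq0 => /eqP->.
  by rewrite scalerN opprK scalerA div_mulVr // scale1r.
have [i Mi0] := nzrow M0.
apply/eqP; rewrite eqn_leq; apply/andP; split; last first.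
  by rewrite -(cards1 i); apply: leq_bigmax_cond; apply/asboolP/ind1.
apply/bigmax_leqP => S /asboolP indS; rewrite leqNgt; apply/negP.
move=> /card_gt1P[j [k [Sj Sk jNk]]].
have rowE l : row l M = c l 0 *: r.
  by rewrite defM row_mul; apply/rowP => h; rewrite !mxE big_ord1 !mxE.
have c0 l : l \in S -> c l 0 != 0.
  move=> Sl; apply/eqP => cl0; suff /eqP : (1 : D) = 0 by rewrite oner_eq0.
  suff : (l == l)%:R = 0 :> D by rewrite eqxx.
  apply: (indS (fun h => (h == l)%:R)) Sl; apply: big1 => h _.
  by case: eqP => [->|_]; rewrite ?scale0r // rowE cl0 scale0r scaler0.
(* These coefficients turn the rows [j] and [k] into [r] and [- r]. *)
pose a l := if l == j then (c j 0)^-1 else if l == k then - (c k 0)^-1 else 0.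
suff /eqP : a j = 0 by rewrite /a eqxx; apply/negP/div_invr_neq0/c0.
apply: (indS a _ j Sj); rewrite (bigD1 j) //= (bigD1 k) ?Sk 1?eq_sym // big1.
  rewrite /a eqxx [k == j]eq_sym (negPf jNk) eqxx !rowE !scalerA mulNr.
  by rewrite /= addr0 !div_mulVr ?c0 // scale1r scaleN1r subrr.
by move=> h /andP[/andP[_ hNj] hNk]; rewrite /a (negPf hNj) (negPf hNk) scale0r.
Qed.

Lemma row_regularMr (r m : nat) (U : 'M[D]_(r, m)) (P Q : 'M[D]_m) :
  Q *m P = 1%:M -> row_regular U -> row_regular (U *m Q).
Proof.
move=> QP regU x xUQ; apply: regU.
by rewrite -[U]mulmx1 -QP !mulmxA -[x *m U *m Q]mulmxA xUQ mul0mx.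
Qed.

(** A column transposition brings a nonzero entry to the front; an elementary column operation then
    normalizes it and clears the others. *)
Lemma row_echelon1 (m : nat) (u : 'rV[D]_(1 + m)) : u != 0 ->
  exists P Q : 'M_(1 + m),
    [/\ P *m Q = 1%:M, Q *m P = 1%:M & u *m Q = row_mx 1%:M 0].
Proof.
move=> u0; have [j uj0] : exists j, u 0 j != 0.
  apply: contrapT => nz; move/negP: u0; apply; apply/eqP/rowP => j.
  by rewrite mxE; apply/eqP; apply: contrapT => /negP ?; apply: nz; exists j.
pose T : 'M[D]_(1 + m) := perm_mx (tperm 0 j).
have TT : T *m T = 1%:M by rewrite -perm_mxM tperm2 perm_mx1.
pose d := (u *m T) 0 0; pose v : 'rV_m := rsubmx (u *m T).
have d0 : d != 0.
  by rewrite /d /T -tpermV -col_permE mxE tpermL.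
have uT : u *m T = row_mx d%:M v.
  rewrite -[LHS]hsubmxK; congr row_mx; apply/rowP => k.
  by rewrite !mxE !ord1 eqxx lshift0 mulr1n /d !mxE.
exists (block_mx d%:M v 0 1%:M *m T),
  (T *m block_mx d^-1%:M (- d^-1 *: v) 0 1%:M).
split.
- rewrite mulmxA -[_ *m T *m T]mulmxA TT mulmx1 mulmx_block.
  rewrite !mulmx0 !mul0mx !addr0 !mulmx1 !mul_scalar_mx scalerA mulrN.
  rewrite scale_scalar_mx div_mulrV // scaleN1r addNr add0r.
  by rewrite -scalar_mx_block.
- rewrite mulmxA -[T *m _ *m _]mulmxA mulmx_block.
  rewrite !mulmx0 !mul0mx !addr0 !mulmx1 !mul_scalar_mx scaleNr subrr add0r.
  by rewrite scale_scalar_mx div_mulVr // -scalar_mx_block mulmx1.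
- rewrite mulmxA uT mul_row_block !mulmx0 !addr0 mulmx1 !mul_scalar_mx scalerA.
  by rewrite mulrN scale_scalar_mx div_mulrV // scaleN1r addNr.
Qed.

(** Induction on the number of rows. Once the first row is [1 0], the other rows read [v W], and [W]
    inherits regularity. Independence of the rows is what makes column operations sufficient. *)
Lemma row_echelon (r m : nat) (U : 'M[D]_(r, m)) : row_regular U ->
  (r <= m)%N /\
  exists P Q : 'M_m, [/\ P *m Q = 1%:M, Q *m P = 1%:M & U *m Q = pid_mx r].
Proof.
elim: r m U => [|r IHr] m U regU.
  split=> //; exists 1%:M, 1%:M; rewrite !mulmx1; split=> //.
  by apply/matrixP => [[]].
have u0 : row 0 U != 0.
  apply/eqP => u0; have /rowP/(_ 0) : delta_mx 0 0 = 0 :> 'rV[D]_r.+1.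
    by apply: regU; rewrite -rowE.
  by rewrite !mxE !eqxx /= => /eqP; rewrite oner_eq0.
case: m U regU u0 => [|m] U regU u0.
  by move/eqP: u0; case; apply/rowP => [[]].
have [P1 [Q1 [PQ1 QP1 uQ1]]] := row_echelon1 u0.
pose V : 'M_(1 + r, 1 + m) := U *m Q1.
have regV : row_regular V by apply: row_regularMr regU; exact: QP1.
pose v : 'cV_r := dlsubmx V; pose W : 'M_(r, m) := drsubmx V.
have defV : V = block_mx 1%:M 0 v W.
  rewrite -[LHS]submxK /block_mx -uQ1; congr col_mx.
  rewrite /ulsubmx /ursubmx hsubmxK; apply/rowP => k.
  rewrite mxE lshift0 /V; by rewrite !mxE; apply: eq_bigr => l _; rewrite !mxE.
have regW : row_regular W.
  move=> x xW; have : row_mx (- x *m v) x = 0 :> 'rV_(1 + r).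
    apply: regV; rewrite defV mul_row_block mulmx1 mulmx0 xW.
    by rewrite mulNmx addNr addr0 row_mx0.
  by rewrite -[RHS]row_mx0 => /eq_row_mx[].
have [le_rm [P2 [Q2 [PQ2 QP2 WQ2]]]] := IHr _ _ regW.
have [P [Q [PQ QP VQ]]] : exists P Q : 'M_(1 + m),
    [/\ P *m Q = 1%:M, Q *m P = 1%:M
      & V *m Q = block_mx 1%:M 0 0 (pid_mx r)].
  (* [w] is [v] padded with zeros, so that [W *m Q2 *m w = v]; subtracting [Q2 *m w] in the first
     block column clears [v]. *)
  pose w : 'cV_m := pid_mx r *m v.
  exists (block_mx 1%:M 0 w P2), (block_mx 1%:M 0 (- (Q2 *m w)) Q2); split.
  - rewrite mulmx_block !mulmx0 !mul0mx !addr0 !mulmx1 mulmxN mulmxA PQ2.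
    by rewrite mul1mx subrr add0r -scalar_mx_block.
  - rewrite mulmx_block !mulmx0 !mul0mx !addr0 !mulmx1 QP2 addNr add0r.
    by rewrite -scalar_mx_block.
  - rewrite defV mulmx_block !mulmx0 !mul0mx !addr0 !mulmx1 !add0r WQ2.
    by rewrite mulmxN mulmxA WQ2 mulmxA pid_mx_id // pid_mx_1 mul1mx subrr.
split=> //; exists (P *m P1), (Q1 *m Q); split.
- by rewrite mulmxA -[_ *m P1 *m _]mulmxA PQ1 mulmx1.
- by rewrite mulmxA -[Q1 *m _ *m _]mulmxA QP mulmx1.
- rewrite mulmxA -/V; apply: etrans VQ _; apply/matrixP => i k; rewrite !mxE.
  by do 2![case: split_ordP => ? ->; rewrite !mxE ?ord1]; rewrite ?ltnS.
Qed.

Lemma row_regular_inv (r : nat) (K : 'M[D]_r) : row_regular K ->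
  exists2 J, K *m J = 1%:M & J *m K = 1%:M.
Proof.
move=> /row_echelon[_ [P [Q [PQ QP]]]]; rewrite pid_mx_1 => KQ; exists Q => //.
suff -> : K = P by [].
by rewrite -[LHS]mulmx1 -QP mulmxA KQ mul1mx.
Qed.

End DivisionRing.

(** * Hermitian forms *)

Section Involution.

Variables (D : unitRingType) (divD : division_ring D).
Variables (s : D -> D) (invs : ring_involution s).

Lemma involD : {morph s : x y / x + y}. Proof. by case: invs => [[]]. Qed.
Lemma invol1 : s 1 = 1. Proof. by case: invs => [[]]. Qed.
Lemma involM : {morph s : x y / x * y >-> y * x}.
Proof. by case: invs => [[]]. Qed.
Lemma involK : involutive s. Proof. by case: invs. Qed.

Lemma invol0 : s 0 = 0.
Proof. by apply: (addrI (s 0)); rewrite -involD !addr0. Qed.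

Lemma involN : {morph s : x / - x}.
Proof. by move=> x; apply: (addrI (s x)); rewrite -involD !subrr invol0. Qed.

Lemma involV (x : D) : x != 0 -> s x^-1 = (s x)^-1.
Proof.
move=> x0; have sx0 : s x != 0.
  by apply: contra_neq x0 => sx0; rewrite -[x]involK sx0 invol0.
rewrite -[LHS]mul1r -(div_mulVr divD sx0) -mulrA -involM div_mulVr //.
by rewrite invol1 mulr1.
Qed.

Definition starmx (m n : nat) (M : 'M[D]_(m, n)) : 'M[D]_(n, m) :=
  (map_mx s M)^T.

Lemma starmxK (m n : nat) (M : 'M[D]_(m, n)) : starmx (starmx M) = M.
Proof. by apply/matrixP => i j; rewrite !mxE involK. Qed.

Lemma starmxD (m n : nat) (M N : 'M[D]_(m, n)) :
  starmx (M + N) = starmx M + starmx N.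
Proof. by apply/matrixP => i j; rewrite !mxE involD. Qed.

Lemma starmxN (m n : nat) (M : 'M[D]_(m, n)) : starmx (- M) = - starmx M.
Proof. by apply/matrixP => i j; rewrite !mxE involN. Qed.

Lemma starmx0 (m n : nat) : starmx (0 : 'M[D]_(m, n)) = 0.
Proof. by apply/matrixP => i j; rewrite !mxE invol0. Qed.

Lemma starmx_scalar (n : nat) (a : D) : starmx (a%:M : 'M_n) = (s a)%:M.
Proof.
apply/matrixP => i j; rewrite !mxE eq_sym.
by case: eqP => _; rewrite ?mulr1n ?mulr0n ?invol0.
Qed.

Lemma starmx1 (n : nat) : starmx (1%:M : 'M_n) = 1%:M.
Proof. by rewrite starmx_scalar invol1. Qed.

Lemma starmxM (m n p : nat) (M : 'M[D]_(m, n)) (N : 'M[D]_(n, p)) :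
  starmx (M *m N) = starmx N *m starmx M.
Proof.
apply/matrixP => i j; rewrite !mxE (big_morph s involD invol0).
by apply: eq_bigr => k _; rewrite !mxE involM.
Qed.

Lemma starmxZ (m n : nat) (a : D) (M : 'M[D]_(m, n)) :
  starmx (a *: M) = starmx M *m (s a)%:M.
Proof. by rewrite -mul_scalar_mx starmxM starmx_scalar. Qed.

Lemma starmx_row_mx (m n p : nat) (M : 'M[D]_(m, n)) (N : 'M[D]_(m, p)) :
  starmx (row_mx M N) = col_mx (starmx M) (starmx N).
Proof. by rewrite /starmx map_row_mx tr_row_mx. Qed.

Lemma starmx_col_mx (m n p : nat) (M : 'M[D]_(m, p)) (N : 'M[D]_(n, p)) :
  starmx (col_mx M N) = row_mx (starmx M) (starmx N).
Proof. by rewrite /starmx map_col_mx tr_col_mx. Qed.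

Lemma starmx_block_mx (m n p q : nat) (A : 'M[D]_(m, p)) (B : 'M[D]_(m, q))
    (C : 'M[D]_(n, p)) (E : 'M[D]_(n, q)) :
  starmx (block_mx A B C E) =
  block_mx (starmx A) (starmx C) (starmx B) (starmx E).
Proof. by rewrite /starmx map_block_mx tr_block_mx. Qed.

(** A Hermitian [X] with [U *m X = N] makes [N *m starmx U] equal to [U *m X *m starmx U], so the
    first hypothesis is forced. All separating matrices below come from this interpolation on one or
    two rows. *)
Lemma hermitian_extension (r n : nat) (U N : 'M[D]_(r, n)) :
    starmx (N *m starmx U) = N *m starmx U -> row_regular (N *m starmx U) ->
  exists X : 'M[D]_n, [/\ starmx X = X, row_regular X & U *m X = N].
Proof.
move=> hermK regK.
have regU : row_regular U.
  by move=> x xU; apply: regK; rewrite -hermK starmxM starmxK mulmxA xU mul0mx.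
have [/subnKC def_n [P [Q]]] := row_echelon divD regU.
move: (n - r)%N def_n => m def_n; clear regU.
case: n / def_n in U N hermK regK P Q *.
set K := N *m starmx U in hermK regK; rewrite pid_mx_row => -[PQ QP UQ].
have [J KJ JK] := row_regular_inv divD regK.
have hermJ : starmx J = J.
  by rewrite -[LHS]mulmx1 -KJ mulmxA -hermK -starmxM KJ starmx1 mul1mx.
pose L := rsubmx (N *m starmx P).
(* As [U *m Q] is [1 0], the left block is [N *m starmx P *m starmx (U *m Q)], which is
   [N *m starmx U] because [Q *m P = 1%:M]. *)
have NP : N *m starmx P = row_mx K L.
  rewrite -[LHS]hsubmxK; congr row_mx; rewrite -[LHS]mulmx1.
  have -> : lsubmx (N *m starmx P) *m 1%:M = N *m starmx P *m starmx (U *m Q).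
    by rewrite -[in RHS](hsubmxK (N *m starmx P)) UQ starmx_row_mx starmx1
      starmx0 mul_row_col mulmx0 addr0.
  rewrite starmxM mulmxA -[_ *m starmx P *m _]mulmxA -starmxM QP.
  by rewrite starmx1 mulmx1.
(* In coordinates where U = [1 0], X is [[K, L], [L^*, M]] with M free; this M
   makes the Schur complement of K the identity. *)
pose Y := block_mx K L (starmx L) (starmx L *m J *m L + 1%:M).
have hermY : starmx Y = Y.
  rewrite starmx_block_mx hermK starmxK starmxD !starmxM starmxK hermJ.
  by rewrite starmx1 mulmxA.
have regY : row_regular Y.
  move=> x; rewrite -[x]hsubmxK mul_row_block -[RHS]row_mx0 => /eq_row_mx[].
  set a := lsubmx x; set b := rsubmx x.
  move=> /eqP; rewrite addr_eq0 => /eqP aK.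
  have -> : a = - (b *m starmx L *m J) by rewrite -mulNmx -aK -mulmxA KJ mulmx1.
  rewrite mulmxDr mulmx1 !mulmxA mulNmx addrA addNr add0r => ->.
  by rewrite !mul0mx oppr0 row_mx0.
exists (Q *m Y *m starmx Q); split.
- by rewrite !starmxM starmxK hermY mulmxA.
- move=> x xX; suff xQ : x *m Q = 0.
    by rewrite -[x]mulmx1 -QP mulmxA xQ mul0mx.
  apply: regY; rewrite -[LHS]mulmx1 -[1%:M]starmx1 -PQ starmxM mulmxA.
  by move: xX; rewrite !mulmxA => ->; rewrite mul0mx.
- rewrite !mulmxA UQ mul_row_block !mul1mx !mul0mx !addr0 -NP.
  by rewrite -mulmxA -starmxM QP starmx1 mulmx1.
Qed.

Definition hform (n : nat) (A : 'M[D]_n) (x y : 'rV_n) : D :=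
  (x *m A *m starmx y) 0 0.

Section Forms.

Variable n : nat.
Implicit Types (A B : 'M[D]_n) (x y z : 'rV[D]_n).

Lemma hformDl A x y z : hform A (x + y) z = hform A x z + hform A y z.
Proof. by rewrite /hform !mulmxDl mxE. Qed.

Lemma hformZl A a x z : hform A (a *: x) z = a * hform A x z.
Proof. by rewrite /hform -!scalemxAl mxE. Qed.

Lemma hformDr A x y z : hform A x (y + z) = hform A x y + hform A x z.
Proof. by rewrite /hform starmxD mulmxDr mxE. Qed.

Lemma hformZr A a x z : hform A x (a *: z) = hform A x z * s a.
Proof.
rewrite /hform starmxZ mulmxA [LHS]mxE big_ord1 [X in _ * X]mxE eqxx.
by rewrite mulr1n.
Qed.

Lemma hform0l A z : hform A 0 z = 0.
Proof. by rewrite /hform !mul0mx mxE. Qed.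

Lemma hformB A B x y : hform (A - B) x y = hform A x y - hform B x y.
Proof. by rewrite /hform mulmxBr mulmxBl !mxE. Qed.

Lemma hformBC A B x y : hform (A - B) x y = - hform (B - A) x y.
Proof. by rewrite !hformB opprB. Qed.

Lemma hform_delta A i j : hform A (delta_mx 0 i) (delta_mx 0 j) = A i j.
Proof.
rewrite /hform; have -> : starmx (delta_mx 0 j : 'rV_n) = delta_mx j 0.
  apply/matrixP => k l; rewrite !mxE ord1 !eqxx andbT.
  by case: eqP => _; rewrite ?invol0 ?invol1.
by rewrite -mulmxA -colE -rowE !mxE.
Qed.

Lemma hform_sym A x y : starmx A = A -> s (hform A x y) = hform A y x.
Proof.
move=> hermA; suff -> : hform A y x = starmx (x *m A *m starmx y) 0 0
  by rewrite [RHS]mxE [in RHS]mxE.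
by rewrite !starmxM starmxK hermA mulmxA.
Qed.

Hypothesis R2 : restriction_R2 s.

(** If all traces vanish, [s] is negation; then [s 1 = 1] gives characteristic 2, where negation is
    the identity, against [R2]. *)
Lemma trace_neq0 : exists d, d + s d != 0.
Proof.
apply: contrapT => /forallNP tr0.
have {}tr0 d : s d = - d.
  by apply/eqP; rewrite -addr_eq0 addrC; apply: contrapT => /negP; apply: tr0.
have two0 : 1 + 1 = 0 :> D by rewrite -{2}invol1 tr0 subrr.
have : 2%N \notin [pchar D].
  apply: R2 => x; rewrite tr0; apply/esym/eqP; rewrite -addr_eq0.
  by rewrite -[x]mul1r -mulrDl two0 mul0r.
by rewrite inE /= -[2%:R]/(1 + 1) two0 eqxx.
Qed.

(** By polarization, if all vectors are isotropic then every value of the form has trace zero. A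
    nonzero value can be rescaled to any [d], which contradicts [trace_neq0]. *)
Lemma anisotropic_vector A : starmx A = A -> A != 0 ->
  exists v, hform A v v != 0.
Proof.
move=> hermA; apply: contra_neqP => /forallNP iso0.
have {}iso0 v : hform A v v = 0.
  by apply/eqP; apply: contrapT => /negP; apply: iso0.
have alt x y : hform A x y + s (hform A x y) = 0.
  have := iso0 (x + y).
  by rewrite hformDl !hformDr !iso0 add0r addr0 hform_sym.
have [d dN0] := trace_neq0.
apply/matrixP => i j; rewrite mxE -hform_delta; apply/eqP.
apply: contrapT => /negP k0; move/negP: dN0; apply; apply/eqP.
have := alt ((d * (hform A (delta_mx 0 i) (delta_mx 0 j))^-1) *: delta_mx 0 i)
  (delta_mx 0 j).
by rewrite hformZl -mulrA div_mulVr // mulr1.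
Qed.

(* If A is not the rank one matrix below, its Schur complement with respect to
   e is a nonzero Hermitian form, hence has an anisotropic vector. *)
Lemma orthogonal_pair A e : starmx A = A -> hform A e e != 0 ->
    A <> A *m starmx e *m ((hform A e e)^-1 *: (e *m A)) ->
  exists2 f, hform A e f = 0 & hform A f f != 0.
Proof.
set p := hform A e e => hermA p0 /eqP; rewrite -subr_eq0.
set S := A - _ => SN0.
have sp : s p = p by apply: hform_sym.
have hermS : starmx S = S.
  rewrite /S starmxD starmxN hermA; congr (_ - _).
  rewrite !starmxM starmxZ starmxM hermA starmxK involV // sp.
  by rewrite -!mulmxA mul_scalar_mx.
have [f0] := anisotropic_vector hermS SN0.
have SE x y : hform S x y = hform A x y - hform A x e * p^-1 * hform A e y.
  rewrite /S hformB; congr (_ - _).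
  rewrite /hform !mulmxA -(mulmxA (x *m A *m starmx e)) [LHS]mxE.
  rewrite big_ord1 -mulrA.
  by congr (_ * _); rewrite -scalemxAl mxE.
(* Gram-Schmidt: [f] is orthogonal to [e], and the value of [A] at [f] is that of [S] at [f0]. *)
set f := f0 - (hform A f0 e * p^-1) *: e.
have fe : hform A f e = 0.
  by rewrite hformDl -scaleNr hformZl mulNr -mulrA div_mulVr // mulr1 subrr.
have ef : hform A e f = 0 by rewrite -hform_sym // fe invol0.
move=> Sf0; exists f => //.
rewrite {2}/f hformDr -scaleNr hformZr fe mul0r addr0.
by rewrite hformDl -scaleNr hformZl mulNr -SE.
Qed.

End Forms.

Lemma central_notin (l : seq D) : restriction_R1 s -> (size l <= 3)%N ->
  exists t, [/\ s t = t, forall y, t * y = y * t & t \notin l].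
Proof.
move=> R1 sz_l; apply: contrapT => /forallNP notl; apply: R1.
(* The image of [I_3] under [nth 0 l] contains every member of [l]. *)
apply: card_le_trans (card_image_le (nth 0 l) `I_3); apply: subset_card_le.
move=> t [/= st ct]; have lt : t \in l.
  by apply: contrapT => /negP lt; apply: (notl t); split.
exists (index t l); last by rewrite nth_index.
by rewrite /= (leq_trans _ sz_l) // index_mem.
Qed.

(* The bad t are 0 and the square roots of -1/k, at most three in all; this is
   where more than three central symmetric elements are needed. *)
Lemma central_square_avoid (k : D) : restriction_R1 s ->
  exists t, [/\ s t = t, forall y, t * y = y * t, t != 0
    & 1 + t * t * k != 0].
Proof.
move=> R1; have [t [st ct]] := central_notin (l := [:: 0]) R1 isT.
rewrite inE => t0; have [tk|] := eqVneq (1 + t * t * k) 0; last by exists t.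
have [u [su cu]] := central_notin (l := [:: 0; t; - t]) R1 isT.
rewrite !inE !negb_or => /and3P[u0 ut uNt]; exists u; split=> //.
apply/eqP => uk; have : (t - u) * (t + u) * k = 0.
  have ttk : t * t * k = u * u * k by apply: (addrI 1); rewrite tk uk.
  by rewrite mulrDr 2!mulrBl (cu t) addrA subrK mulrBl ttk subrr.
move=> /(div_mulf_eq0 divD)[/(div_mulf_eq0 divD)[]|] /eqP.
- by rewrite subr_eq0 eq_sym (negPf ut).
- by rewrite addrC addr_eq0 (negPf uNt).
- by move=> /eqP k0; move/eqP: uk; rewrite k0 mulr0 addr0 oner_eq0.
Qed.

End Involution.

(** * Separating nonadjacent matrices *)

Section GoodPairs.

Variables (D : unitRingType) (divD : division_ring D).
Variables (s : D -> D) (invs : ring_involution s).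
Variable n : nat.
Implicit Types (A B : 'M[D]_n) (e f u v w : 'rV[D]_n).

(* The last clause says that the 2 x 2 matrix
   [[A(u,u), A(u,w)], [B(w,u), B(w,w)]] is row regular. *)
Definition good_pair A B u w :=
  hform s (A - B) u w = 0 /\
  forall x y, x * hform s A u u + y * hform s B w u = 0 ->
    x * hform s A u w + y * hform s B w w = 0 -> x = 0 /\ y = 0.

Lemma good_pair_swap A B u w : starmx s A = A -> starmx s B = B ->
  good_pair B A w u -> good_pair A B u w.
Proof.
move=> hermA hermB [wu reg]; split=> [|x y xy1 xy2].
  rewrite -(hform_sym invs) ?(starmxD invs) ?(starmxN invs) ?hermA ?hermB //.
  by rewrite hformB -opprB -hformB wu oppr0 (invol0 invs).
by have [] := reg y x; rewrite // addrC.
Qed.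

(** Interpolate [u X = u A] and [w X = w B]: then [u] kills [X - A] and [w] kills [X - B].
    Regularity of the 2 x 2 matrix also forces [u] and [w] to be nonzero. *)
Lemma good_pair_witness A B u w : starmx s A = A -> starmx s B = B ->
  good_pair A B u w ->
  exists X, [/\ starmx s X = X, row_regular X,
    ~ row_regular (X - A) & ~ row_regular (X - B)].
Proof.
move=> hermA hermB [orth reg].
pose U : 'M_(1 + 1, n) := col_mx u w.
pose N : 'M_(1 + 1, n) := col_mx (u *m A) (w *m B).
have NU : N *m starmx s U =
    block_mx (u *m A *m starmx s u) (u *m A *m starmx s w)
    (w *m B *m starmx s u) (w *m B *m starmx s w).
  by rewrite starmx_col_mx mul_col_row.
(* Orthogonality for [A - B] is what makes the 2 x 2 matrix Hermitian. *)
have uw : u *m A *m starmx s w = u *m B *m starmx s w.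
  apply/eqP; rewrite -subr_eq0 -mulmxBl -mulmxBr; apply/eqP.
  by apply/matrixP => i j; rewrite !ord1 [RHS]mxE.
have [||X [hermX regX UX]] := @hermitian_extension _ divD _ invs _ _ U N.
- rewrite NU (starmx_block_mx s); congr block_mx.
  + by rewrite !(starmxM invs) (starmxK invs) hermA mulmxA.
  + by rewrite uw !(starmxM invs) (starmxK invs) hermB mulmxA.
  + by rewrite uw !(starmxM invs) (starmxK invs) hermB mulmxA.
  + by rewrite !(starmxM invs) (starmxK invs) hermB mulmxA.
- move=> x; rewrite NU -[x]hsubmxK [lsubmx x]mx11_scalar [rsubmx x]mx11_scalar.
  set a := lsubmx x 0 0; set b := rsubmx x 0 0.
  rewrite mul_row_block !mul_scalar_mx -[RHS]row_mx0.
  move=> /eq_row_mx[/rowP/(_ 0) ab1 /rowP/(_ 0) ab2].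
  have [||-> ->] := reg a b; last first.
  + by rewrite -[0%:M]scalemx1 scale0r row_mx0.
  + by move: ab2; rewrite mxE [X in X + _]mxE [X in _ + X]mxE [RHS]mxE.
  + by move: ab1; rewrite mxE [X in X + _]mxE [X in _ + X]mxE [RHS]mxE.
move: UX; rewrite mul_col_mx => /eq_col_mx[uX wX].
exists X; split=> //.
- move=> /(_ u); rewrite mulmxBr uX subrr => /(_ erefl) u0.
  have [||/eqP] := reg 1 0; last by rewrite oner_eq0.
  + by rewrite u0 hform0l mulr0 mul0r addr0.
  + by rewrite u0 hform0l mulr0 mul0r addr0.
- move=> /(_ w); rewrite mulmxBr wX subrr => /(_ erefl) w0.
  have [||_ /eqP] := reg 0 1; last by rewrite oner_eq0.
  + by rewrite w0 hform0l mulr0 mul0r addr0.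
  + by rewrite w0 hform0l mulr0 mul0r addr0.
Qed.

Hypotheses (R1 : restriction_R1 s) (R2 : restriction_R2 s).

(** The matrices of (e, f) and (f, e) are [[a, 1], [1, c']] and [[c, 1], [1, a']], so one of these
    pairs is good unless [a * c' = c * a' = 1]. In that case the pair is perturbed inside the plane
    of [e] and [f]. *)
Lemma good_pair_normalized A B e f : starmx s A = A -> starmx s B = B ->
    hform s (A - B) e f = 0 -> hform s (A - B) e e != 0 ->
    hform s (A - B) f f != 0 -> hform s A e f = 1 ->
  exists u w, good_pair A B u w.
Proof.
move=> hermA hermB orth p0 q0 aef.
have hermC : starmx s (A - B) = A - B.
  by rewrite (starmxD invs) (starmxN invs) hermA hermB.
have bef : hform s B e f = 1.
  by move: orth; rewrite hformB aef => /eqP; rewrite subr_eq0 => /eqP.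
have afe : hform s A f e = 1 by rewrite -(hform_sym invs) // aef (invol1 invs).
have bfe : hform s B f e = 1 by rewrite -(hform_sym invs) // bef (invol1 invs).
have cfe : hform s (A - B) f e = 0.
  by rewrite -(hform_sym invs) // orth (invol0 invs).
move: (hformB s A B e e) (hformB s A B f f) p0 q0.
set p := hform s (A - B) e e; set q := hform s (A - B) f f.
have sp : s p = p by apply: hform_sym.
have sq : s q = q by apply: hform_sym.
set a := hform s A e e; set a' := hform s B e e.
set c := hform s A f f; set c' := hform s B f f => defp defq p0 q0.
have sa : s a = a by apply: hform_sym.
have sa' : s a' = a' by apply: hform_sym.
have sc : s c = c by apply: hform_sym.
have sc' : s c' = c' by apply: hform_sym.
have [ac'|ac'] := eqVneq (a * c') 1; last first.
  exists e, f; split=> // x y; rewrite bfe aef !mulr1 -/a -/c' => xy1 xy2.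
  suff x0 : x = 0 by move: xy1; rewrite x0 mul0r add0r.
  have : x * (1 - a * c') = 0.
    move/eqP: xy1; rewrite addrC addr_eq0 => /eqP xy1.
    by rewrite mulrBr mulr1 mulrA -mulNr -xy1.
  case/(div_mulf_eq0 divD) => // /eqP; rewrite subr_eq0 eq_sym.
  by rewrite (negPf ac').
have [ca'|ca'] := eqVneq (c * a') 1; last first.
  exists f, e; split=> // x y; rewrite bef afe !mulr1 -/c -/a' => xy1 xy2.
  suff x0 : x = 0 by move: xy1; rewrite x0 mul0r add0r.
  have : x * (1 - c * a') = 0.
    move/eqP: xy1; rewrite addrC addr_eq0 => /eqP xy1.
    by rewrite mulrBr mulr1 mulrA -mulNr -xy1.
  case/(div_mulf_eq0 divD) => // /eqP; rewrite subr_eq0 eq_sym.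
  by rewrite (negPf ca').
have c'a : c' * a = 1 by rewrite -sa -sc' -(involM invs) ac' (invol1 invs).
have a'c : a' * c = 1 by rewrite -sa' -sc -(involM invs) ca' (invol1 invs).
have c0 : c != 0.
  by apply/eqP => c0; move/eqP: a'c; rewrite c0 mulr0 eq_sym oner_eq0.
have cp0 : c * p != 0 by apply: div_mulf_neq0.
have [d trd] := trace_neq0 invs R2.
(* When a c' = c a' = 1, the pair (e + y f, z e + f) fails to be good only if
   y c p + s (y c p) = 0 or e + y f is isotropic for A - B. *)
pose y0 := d * (c * p)^-1.
have [t [st ct t0 tk]] :=
  central_square_avoid divD (s y0 * p^-1 * y0 * q) R1.
have [y defy] : exists y, y = t * y0 by exists (t * y0).
(* This [z] solves [p * s z + y * q = 0], the orthogonality of the new pair for [A - B]. *)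
have [z defz] : exists z, z = - (q * s y * p^-1) by eexists.
have sz : s z = - (p^-1 * y * q).
  rewrite defz (involN invs) !(involM invs) (involK invs) sq.
  by rewrite (involV divD invs) // sp mulrA.
exists (e + y *: f), (z *: e + f); split.
  rewrite !hformDl !(hformDr invs) !hformZl !(hformZr invs) orth cfe.
  rewrite mul0r !mulr0 addr0 add0r -/p -/q sz mulrN !mulrA div_mulrV //.
  by rewrite mul1r addNr.
move=> x1 x2; set u := e + _; set w := _ + f.
pose phi v := x1 * hform s A u v + x2 * hform s B w v.
have phiD v v' : phi (v + v') = phi v + phi v'.
  by rewrite /phi !(hformDr invs) !mulrDr addrACA.
have phiZ g v : phi (g *: v) = phi v * s g.
  by rewrite /phi !(hformZr invs) !mulrA mulrDl.
rewrite -/(phi u) -/(phi w) {1}/u {1}/w !phiD !phiZ => phiu phiw.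
(* [phi] is semilinear and vanishes at [u] and [w]. These span the same plane as [e] and [f] by the
   choice of [t], so [phi] vanishes at [e] and [f] too. *)
have phif : phi f = 0.
  have syz : s y * (p^-1 * y * q) = t * t * (s y0 * p^-1 * y0 * q).
    rewrite defy (involM invs) st -(ct (s y0)) -!mulrA; congr (_ * _).
    rewrite (mulrA p^-1 t) -(ct p^-1) -mulrA (mulrA (s y0) t) -(ct (s y0)).
    by rewrite -!mulrA.
  have : phi f * (1 + t * t * (s y0 * p^-1 * y0 * q)) = 0.
    move/eqP: phiu; rewrite addr_eq0 => /eqP phie.
    rewrite -[RHS]phiw phie sz -syz addrC mulrDr mulr1.
    by rewrite mulrN mulNr opprK mulrA.
  by case/(div_mulf_eq0 divD) => // /eqP; rewrite (negPf tk).
have phie : phi e = 0 by move: phiu; rewrite phif mul0r addr0.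
move: phie phif; rewrite /phi /u /w !hformDl !hformZl afe aef bfe bef.
rewrite -/a -/a' -/c -/c' !mulr1 => E1 E2.
have x12 : x1 + x2 * c' = 0.
  suff : (x1 + x2 * c') * p = 0.
    by case/(div_mulf_eq0 divD) => // /eqP; rewrite (negPf p0).
  (* Subtract [E2] times [a'] from [E1]; the terms in [y] and [z] cancel since [c * a' = 1]. *)
  have E : x1 * a + x2 = x1 * a' + x2 * (c' * a').
    apply: (addIr (x1 * y + x2 * (z * a'))).
    transitivity (0 : D).
      by rewrite -[RHS]E1 !mulrDr mulr1 addrACA [x2 + _]addrC.
    rewrite -[LHS](mul0r a') -E2 !mulrDr mulr1 !mulrDl -!mulrA ca' mulr1.
    by rewrite [RHS]addrACA [_ + x2 * (z * a')]addrC.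
  by rewrite defp mulrDl !mulrBr -!mulrA c'a mulr1 addrACA -opprD E subrr.
have : x2 * (z - c' * y * c) = 0.
  move: E2 x12 => /[swap] /eqP; rewrite addr_eq0 => /eqP->.
  rewrite !mulrDr mulr1 addrAC addrCA addrC !mulNr -!mulrA.
  by rewrite [- _ + _]addrC addrA subrK mulrN.
case/(div_mulf_eq0 divD) => [x20|/eqP].
  by move: x12; rewrite x20 mul0r addr0.
(* If [z = c' * y * c], then [a * z * p] equals [y * c * p] by this equation and [- s (y * c * p)]
   by the definition of [z], so [t * (d + s d)] vanishes. *)
rewrite subr_eq0 => /eqP zE; case/negP: trd.
have defq' : q = c' * p * c.
  by rewrite defq defp mulrBr c'a mulrBl mul1r -mulrA a'c mulr1.
have ycp : y * c * p = t * d.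
  by rewrite defy /y0 -!mulrA div_mulVr // mulr1.
have : t * (d + s d) = 0.
  have -> : t * (d + s d) = y * c * p + s (y * c * p).
    by rewrite ycp (involM invs) st mulrDr (ct (s d)).
  have {1}-> : y * c * p = a * z * p by rewrite zE !mulrA ac' mul1r.
  rewrite defz defq' mulrN mulNr !mulrA ac' mul1r -!mulrA div_mulVr // mulr1.
  by rewrite !(involM invs) sp sc -mulrA addNr.
by case/(div_mulf_eq0 divD) => [|->] // /eqP; rewrite (negPf t0).
Qed.

(** Rescaling [f] normalizes the value at (e, f) to 1; the scalar acts through [s] in the second
    argument, whence the [s] in the witness. *)
Lemma good_pair_nonorthogonal A B e f : starmx s A = A -> starmx s B = B ->
    hform s (A - B) e f = 0 -> hform s (A - B) e e != 0 ->
    hform s (A - B) f f != 0 -> hform s A e f != 0 ->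
  exists u w, good_pair A B u w.
Proof.
move=> hermA hermB orth p0 q0 b0.
have sk0 : s (hform s A e f)^-1 != 0.
  apply: contra_neq (div_invr_neq0 divD b0) => sk0.
  by rewrite -[LHS](involK invs) sk0 (invol0 invs).
apply: (good_pair_normalized (e := e) (f := s (hform s A e f)^-1 *: f)) => //.
- by rewrite (hformZr invs) orth mul0r.
- by rewrite hformZl (hformZr invs) (involK invs) !div_mulf_neq0 ?div_invr_neq0.
- by rewrite (hformZr invs) (involK invs) div_mulrV.
Qed.

(** The matrices of (e, f) and (f, e) are diagonal, so each has a zero entry. The mixed choices
    would make [e] or [f] isotropic for [A - B]. *)
Lemma good_pair_orthogonal A B e f : starmx s A = A -> starmx s B = B ->
    hform s (A - B) e f = 0 -> hform s (A - B) e e != 0 ->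
    hform s (A - B) f f != 0 -> hform s A e f = 0 ->
    (forall u w, ~ good_pair A B u w) ->
  hform s A e e = 0 /\ hform s A f f = 0 \/
  hform s B e e = 0 /\ hform s B f f = 0.
Proof.
move=> hermA hermB orth p0 q0 aef nogood.
have bef : hform s B e f = 0.
  by move: orth; rewrite hformB aef sub0r => /eqP; rewrite oppr_eq0 => /eqP.
have afe : hform s A f e = 0 by rewrite -(hform_sym invs) // aef (invol0 invs).
have bfe : hform s B f e = 0 by rewrite -(hform_sym invs) // bef (invol0 invs).
have diag u w : hform s (A - B) u w = 0 -> hform s A u w = 0 ->
    hform s B w u = 0 -> hform s A u u = 0 \/ hform s B w w = 0.
  move=> cuw auw bwu; have [|a0] := eqVneq (hform s A u u) 0; first by left.
  have [|b0] := eqVneq (hform s B w w) 0; first by right.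
  case: (nogood u w); split=> // x y; rewrite auw bwu !mulr0 addr0 add0r.
  move=> xa yb; split.
    by case/(div_mulf_eq0 divD): xa => // /eqP; rewrite (negPf a0).
  by case/(div_mulf_eq0 divD): yb => // /eqP; rewrite (negPf b0).
have cfe : hform s (A - B) f e = 0 by rewrite hformB afe bfe subrr.
have [aee|bff] := diag e f orth aef bfe; have [aff|bee] := diag f e cfe afe bef.
- by left.
- by move: p0; rewrite hformB aee bee subrr eqxx.
- by move: q0; rewrite hformB aff bff subrr eqxx.
- by right.
Qed.

(** Every [v] is a combination of [e], [f] and some [g] orthogonal to both for [A - B]. Vanishing of
    [A] is carried from [e] and [f] to [g], so all vectors are isotropic for [A]. *)
Lemma no_good_pair_eq0 A B e f : starmx s A = A -> starmx s B = B ->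
    (forall u w, ~ good_pair A B u w) ->
    hform s (A - B) e f = 0 -> hform s (A - B) e e != 0 ->
    hform s (A - B) f f != 0 ->
    hform s A e f = 0 -> hform s A e e = 0 -> hform s A f f = 0 ->
  A = 0.
Proof.
move=> hermA hermB nogood orth p0 q0 aef aee aff.
have hermC : starmx s (A - B) = A - B.
  by rewrite (starmxD invs) (starmxN invs) hermA hermB.
have symC x y : hform s (A - B) x y = 0 -> hform s (A - B) y x = 0.
  by move=> xy; rewrite -(hform_sym invs) // xy (invol0 invs).
have symA x y : hform s A x y = 0 -> hform s A y x = 0.
  by move=> xy; rewrite -(hform_sym invs) // xy (invol0 invs).
have step x y : hform s (A - B) x y = 0 -> hform s (A - B) x x != 0 ->
    hform s (A - B) y y != 0 -> hform s A x x = 0 ->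
    hform s A x y = 0 /\ hform s A y y = 0.
  move=> cxy cxx cyy axx.
  have axy : hform s A x y = 0.
    apply/eqP; apply: contrapT => /negP axy.
    have [u [w /nogood]] // :=
      good_pair_nonorthogonal hermA hermB cxy cxx cyy axy.
  split=> //; have [[]//|[bxx _]] :=
    good_pair_orthogonal hermA hermB cxy cxx cyy axy nogood.
  by move: cxx; rewrite hformB axx bxx subrr eqxx.
apply/eqP; apply: contrapT => /negP A0.
have [v /negP] := anisotropic_vector divD invs R2 hermA A0; apply; apply/eqP.
have [g defg] : exists g, g = v
    - (hform s (A - B) v e / hform s (A - B) e e) *: e
    - (hform s (A - B) v f / hform s (A - B) f f) *: f by eexists.
have cge : hform s (A - B) g e = 0.
  rewrite defg !hformDl -!scaleNr !hformZl (symC _ _ orth) mulr0 addr0.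
  by rewrite mulNr -mulrA div_mulVr // mulr1 subrr.
have cgf : hform s (A - B) g f = 0.
  rewrite defg !hformDl -!scaleNr !hformZl orth mulr0 addr0.
  by rewrite mulNr -mulrA div_mulVr // mulr1 subrr.
have [aeg [afg agg]] :
    hform s A e g = 0 /\ hform s A f g = 0 /\ hform s A g g = 0.
  (* If [g] is isotropic for [A - B], [step] does not apply to it, but it applies to [f + g] and
     [e + g], which take the values of [f] and [e]. *)
  have [cgg|cgg] := eqVneq (hform s (A - B) g g) 0; last first.
    have [? ?] := step e g (symC _ _ cge) p0 cgg aee.
    by have [? ?] := step f g (symC _ _ cgf) q0 cgg aff.
  have := step e (f + g); rewrite !hformDl !(hformDr invs) orth (symC _ _ cge).
  rewrite (symC _ _ cgf) cgf cgg aef aff !addr0 !add0r.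
  move=> /(_ erefl p0 q0 aee)[aeg +]; rewrite aeg.
  have := step f (e + g); rewrite !hformDl !(hformDr invs) (symC _ _ orth).
  rewrite (symC _ _ cge) (symC _ _ cgf) cge cgg (symA _ _ aef) aeg aee.
  rewrite !addr0 !add0r.
  move=> /(_ erefl q0 p0 aff)[afg _].
  by rewrite afg (symA _ _ afg) !add0r => ->.
have -> : v = g + (hform s (A - B) v f / hform s (A - B) f f) *: f
    + (hform s (A - B) v e / hform s (A - B) e e) *: e.
  by rewrite defg subrK subrK.
rewrite !hformDl !(hformDr invs) !hformZl !(hformZr invs) agg aeg afg.
by rewrite aee aff aef !(symA _ _ aeg) (symA _ _ afg) (symA _ _ aef)
  !mul0r !mulr0 !addr0.
Qed.

(** This is the converse half of the adjacency criterion, with [P] translated to 0. Rank different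
    from one enters only to obtain [f]. *)
Lemma nonadjacent_witness A B : starmx s A = A -> starmx s B = B ->
    A <> 0 -> B <> 0 -> A <> B -> left_row_rank (A - B) <> 1%N ->
  exists X, [/\ starmx s X = X, row_regular X,
    ~ row_regular (X - A) & ~ row_regular (X - B)].
Proof.
move=> hermA hermB A0 B0 AB rkAB.
have hermC : starmx s (A - B) = A - B.
  by rewrite (starmxD invs) (starmxN invs) hermA hermB.
have C0 : A - B != 0 by rewrite subr_eq0; apply/eqP.
have [e p0] := anisotropic_vector divD invs R2 hermC C0.
have [|f orth q0] := orthogonal_pair divD invs R2 hermC p0.
  move=> CE; apply: rkAB; apply/left_row_rank1P => //; split; first exact/eqP.
  exists ((A - B) *m starmx s e).
  by exists ((hform s (A - B) e e)^-1 *: (e *m (A - B))).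
suff [u [w good]] : exists u w, good_pair A B u w.
  exact: good_pair_witness good.
apply: contrapT => nogood; have {}nogood u w : ~ good_pair A B u w.
  by move=> good; apply: nogood; exists u, w.
have aef : hform s A e f = 0.
  apply/eqP; apply: contrapT => /negP aef.
  by have [u [w /nogood]] := good_pair_nonorthogonal hermA hermB orth p0 q0 aef.
have [[aee aff]|[bee bff]] :=
  good_pair_orthogonal hermA hermB orth p0 q0 aef nogood.
  exact/A0/(no_good_pair_eq0 hermA hermB nogood orth p0 q0).
apply/B0/(@no_good_pair_eq0 B A e f) => //.
- by move=> u w /(good_pair_swap hermA hermB)/nogood.
- by rewrite hformBC orth oppr0.
- by rewrite hformBC oppr_eq0.
- by rewrite hformBC oppr_eq0.
- by move: orth; rewrite hformB aef sub0r => /eqP; rewrite oppr_eq0 => /eqP.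
Qed.

End GoodPairs.

(** * Adjacency in terms of opposition *)

Lemma mul_mx_central (R : pzRingType) (m n : nat) (M : 'M[R]_(m, n)) (t : R) :
  (forall y, t * y = y * t) -> M *m t%:M = t *: M.
Proof.
move=> ct; apply/matrixP => i j; rewrite !mxE (bigD1 j) //= big1 => [|k kNj].
  by rewrite mxE eqxx mulr1n addr0 ct.
by rewrite mxE (negPf kNj) mulr0n mulr0.
Qed.

(** Kernel vectors of [Y] and of [Y - c *m r] are both sent by the regular matrix
    [Y - t *: (c *m r)] to multiples of [r], hence are proportional. A common kernel vector would
    then kill the whole pencil. *)
Lemma rank_one_pencil (D : unitRingType) (divD : division_ring D) (m n : nat)
    (Y : 'M[D]_(m, n)) (c : 'cV[D]_m) (r : 'rV[D]_n) (t : D) :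
    (forall y, t * y = y * t) -> row_regular (Y - t *: (c *m r)) ->
  row_regular Y \/ row_regular (Y - c *m r).
Proof.
move=> ct; set C := c *m r; set Z := Y - t *: C => regZ.
have xtC (x : 'rV_m) : x *m (t *: C) = t *: (x *m C).
  rewrite -mul_scalar_mx mulmxA scalemxAl; congr (_ *m _).
  exact: mul_mx_central.
have xC (x : 'rV_m) : x *m C = (x *m c) 0 0 *: r.
  by rewrite /C mulmxA -mul_scalar_mx -mx11_scalar.
have kerN (M : 'M[D]_(m, n)) :
    ~ row_regular M -> exists2 z : 'rV_m, z *m M = 0 & z <> 0.
  by move=> /existsNP[z /not_implyP[zM z0]]; exists z.
apply: contrapT => /not_orP[/kerN[z1 z1Y z10] /kerN[z2 z2Y z20]].
have z1Z : z1 *m Z = (- (t * (z1 *m c) 0 0)) *: r.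
  by rewrite /Z mulmxBr z1Y sub0r xtC xC scalerA scaleNr.
set l1 := - _ in z1Z.
have l10 : l1 != 0.
  by apply/eqP => l10; apply/z10/regZ; rewrite z1Z l10 scale0r.
have z2Z : z2 *m Z = ((1 - t) * (z2 *m c) 0 0) *: r.
  rewrite -scalerA scalerBl scale1r -xC /Z mulmxBr xtC; congr (_ - _).
  by apply/eqP; rewrite -subr_eq0 -mulmxBr z2Y.
set l2 := (1 - t) * _ in z2Z.
have z21 : z2 = (l2 * l1^-1) *: z1.
  apply/eqP; rewrite -subr_eq0; apply/eqP/regZ.
  by rewrite mulmxBl -scalemxAl z1Z z2Z scalerA -mulrA div_mulVr // mulr1 subrr.
have z2Y0 : z2 *m Y = 0 by rewrite z21 -scalemxAl z1Y scaler0.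
have z2C : z2 *m C = 0.
  by apply/esym/eqP; rewrite -[X in X == _]z2Y0 -subr_eq0 -mulmxBr z2Y.
by apply/z20/regZ; rewrite /Z mulmxBr xtC z2C z2Y0 scaler0 subrr.
Qed.

Section HermitianGraph.

Variables (D : unitRingType) (divD : division_ring D).
Variables (s : D -> D) (invs : ring_involution s).
Hypotheses (R1 : restriction_R1 s) (R2 : restriction_R2 s).
Variable n : nat.
Implicit Types A B P X : hermitian_mx s n.

Definition opposite A B := left_row_rank (val A - val B) = n.

Lemma oppositeP A B : opposite A B <-> row_regular (val A - val B).
Proof. exact: left_row_rank_full. Qed.

Lemma hermitianE A : starmx s (val A) = val A.
Proof. exact/eqP/(valP A). Qed.

Lemma hermitian_val (M : 'M[D]_n) : starmx s M = M ->
  exists A, val A = M.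
Proof. by move=> /eqP hermM; exists (exist _ M hermM). Qed.

Lemma hermitian_sub A B : starmx s (val A - val B) = val A - val B.
Proof. by rewrite (starmxD invs) (starmxN invs) !hermitianE. Qed.

Lemma val_subN0 A B : A <> B -> val A - val B <> 0.
Proof. by move=> AB /eqP; rewrite subr_eq0 => /eqP/val_inj. Qed.

(** This gives injectivity of the map. With [e] anisotropic for [B - A], take a regular [Y] with
    [e Y = e (B - A)] and [X = Y + A]; then [e] kills [X - B]. *)
Lemma opposite_separates A B : A <> B ->
  exists2 X, opposite X A & ~ opposite X B.
Proof.
move=> /nesym/val_subN0/eqP BA0.
have [e k0] := anisotropic_vector divD invs R2 (hermitian_sub B A) BA0.
set C := val B - val A in BA0 k0.
have hermC : starmx s C = C by apply: hermitian_sub.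
have [||Y [hermY regY eY]] := @hermitian_extension _ divD _ invs _ _ e (e *m C).
- by rewrite !(starmxM invs) (starmxK invs) hermC mulmxA.
- move=> x; rewrite [e *m C *m _]mx11_scalar [x]mx11_scalar -scalar_mxM.
  rewrite -/(hform s C e e); set k := hform s C e e in k0 *.
  move=> /matrixP/(_ 0 0); rewrite !mxE !eqxx !mulr1n.
  case/(div_mulf_eq0 divD) => [->|/eqP]; last by rewrite (negPf k0).
  by rewrite -[0%:M]scalemx1 scale0r.
have [X defX] : exists X, val X = Y + val A.
  by apply: hermitian_val; rewrite (starmxD invs) hermY hermitianE.
exists X; apply/oppositeP => //; rewrite defX ?addrK //.
move=> /(_ e) e0; move/eqP: k0; apply; rewrite (e0 _) ?hform0l //.
by rewrite mulmxBr mulmxDr eY -mulmxDr subrK subrr.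
Qed.

(** The right-hand side mentions only opposition, so every bijection respecting opposition
    transports it. *)
Lemma adjacentP A B : adjacent A B <->
  A <> B /\ exists P, [/\ P <> A, P <> B &
    forall X, opposite X P -> opposite X A \/ opposite X B].
Proof.
rewrite /adjacent; split=> [/(left_row_rank1P divD)[C0 [c [r defC]]]|].
  split=> [AB|]; first by apply: C0; rewrite AB subrr.
  (* Avoiding 0 and 1 keeps [P] away from [B] and [A]. *)
  have [t [st ct]] := central_notin (l := [:: 0; 1]) R1 isT.
  rewrite !inE negb_or => /andP[t0 t1].
  have [P defP] : exists P, val P = val B + t *: (val A - val B).
    apply: hermitian_val; rewrite (starmxD invs) (starmxZ invs) hermitian_sub.
    by rewrite hermitianE st mul_mx_central.
  have tC u : u != 0 -> u *: (val A - val B) <> 0.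
    move=> u0 uC; apply: C0.
    by rewrite -[LHS]scale1r -(div_mulVr divD u0) -scalerA uC scaler0.
  exists P; split=> [PA|PB|X].
  - apply: (tC (1 - t)); first by rewrite subr_eq0 eq_sym.
    by rewrite scalerBl scale1r -{1}PA defP -addrA -opprD -PA defP subrr.
  - by apply: (tC t) => //; move: defP; rewrite PB => /eqP;
      rewrite -subr_eq0 opprD addrA subrr sub0r oppr_eq0 => /eqP.
  - rewrite !oppositeP defP opprD addrA defC => /(rank_one_pencil divD ct).
    by rewrite -defC opprB addrA subrK => -[]; [right | left].
move=> [AB [P [PA PB sepP]]]; apply: contrapT => rkAB.
have [||||||X [hermX regX XA XB]] := nonadjacent_witness divD invs R1 R2
  (A := val A - val P) (B := val B - val P).
- exact: hermitian_sub.
- exact: hermitian_sub.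
- exact/val_subN0/nesym.
- exact/val_subN0/nesym.
- by move=> /addIr/val_inj.
- by rewrite opprB addrA subrK.
have [X' defX'] : exists X', val X' = X + val P.
  by apply: hermitian_val; rewrite (starmxD invs) hermX hermitianE.
have [||] := sepP X'; rewrite oppositeP defX' ?addrK //.
  by rewrite -addrA -opprB.
by rewrite -addrA -opprB.
Qed.

End HermitianGraph.

(** * Transfer along bijections and equality of dimensions *)

Lemma opposite_preserving_adjacency (D D' : unitRingType)
    (divD : division_ring D) (divD' : division_ring D')
    (s : D -> D) (s' : D' -> D')
    (invs : ring_involution s) (invs' : ring_involution s')
    (R1 : restriction_R1 s) (R1' : restriction_R1 s')
    (R2 : restriction_R2 s) (R2' : restriction_R2 s') (n n' : nat)
    (f : hermitian_mx s n -> hermitian_mx s' n')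
    (g : hermitian_mx s' n' -> hermitian_mx s n) :
    cancel f g -> cancel g f ->
    (forall A B, opposite A B <-> opposite (f A) (f B)) ->
  preserves_adjacency f.
Proof.
move=> fK gK fopp A B /(adjacentP divD invs R1 R2)[AB [P [PA PB sepP]]].
apply/(adjacentP divD' invs' R1' R2'); split; first by move=> /(can_inj fK).
exists (f P); split=> [/(can_inj fK)|/(can_inj fK)|X] //.
by rewrite -[X]gK -!fopp; apply: sepP.
Qed.

(** The diagonal idempotents [d 0], ..., [d n] form a path of [n] adjacent steps with opposite ends.
    The images of the ends differ by a sum of [n] matrices of rank one, which is regular of size
    [n']. *)
Lemma adjacency_preserving_dim (D D' : unitRingType)
    (divD : division_ring D) (divD' : division_ring D')
    (s : D -> D) (s' : D' -> D')
    (invs : ring_involution s) (n n' : nat)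
    (f : hermitian_mx s n -> hermitian_mx s' n') :
    preserves_adjacency f ->
    (forall A B, opposite A B -> opposite (f A) (f B)) ->
  (n' <= n)%N.
Proof.
move=> fadj fopp.
have hermD k :
    starmx s (\matrix_(i < n, j < n) ((i == j) && (i < k)%N)%:R : 'M[D]_n) =
    \matrix_(i < n, j < n) ((i == j) && (i < k)%N)%:R.
  apply/matrixP => i j; rewrite !mxE eq_sym.
  case: eqP => [->|_] /=; last exact: invol0.
  by case: (_ < _)%N; [exact: invol1 | exact: invol0].
pose d k : hermitian_mx s n :=
  exist (@is_hermitian D s n) _ (introT eqP (hermD k)).
have factor k : (k <= n)%N -> exists (U : 'M_(n', k)) (V : 'M_(k, n')),
    val (f (d k)) - val (f (d 0)) = U *m V.
  elim: k => [|k IHk] lt_kn.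
    by exists 0, 0; rewrite subrr mulmx0.
  have [U [V defUV]] := IHk (ltnW lt_kn).
  have : adjacent (d k.+1) (d k).
    pose i0 := Ordinal lt_kn; apply/(left_row_rank1P divD).
    have dE : val (d k.+1) - val (d k) =
        (delta_mx i0 0 : 'cV_n) *m (delta_mx 0 i0 : 'rV_n).
      rewrite mul_delta_mx; apply/matrixP => i j; rewrite !mxE ltnS leq_eqVlt.
      rewrite -[nat_of_ord i == k]/(i == i0).
      case: (i =P j) => [<-|ij] /=.
        case: (i =P i0) => [->|_] /=; first by rewrite ltnn subr0.
        by rewrite subrr.
      rewrite subrr; case: (i =P i0) => //= ii0; case: eqP => // ji0.
      by case: ij; rewrite ii0 ji0.
    split; last by exists (delta_mx i0 0), (delta_mx 0 i0).
    rewrite dE mul_delta_mx => /matrixP/(_ i0 i0)/eqP.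
    by rewrite !mxE !eqxx oner_eq0.
  move=> /fadj/(left_row_rank1P divD')[_ [c [r cr]]].
  exists (row_mx c U), (col_mx r V).
  apply: etrans (esym (mul_row_col c U r V)).
  by rewrite -cr -defUV addrA subrK.
have /fopp/oppositeP : opposite (d n) (d 0).
  apply/oppositeP => x; rewrite /= (_ : _ - _ = 1%:M) ?mulmx1 //.
  by apply/matrixP => i j; rewrite !mxE ltn_ord ltn0 andbT andbF subr0.
have [U [V ->]] := factor n (leqnn n) => regUV.
(* The left factor [U] has [n'] rows and [n] columns and inherits regularity from the product. *)
have [] // := @row_echelon _ divD' _ _ U.
by move=> x xU; apply: regUV; rewrite mulmxA xU mul0mx.
Qed.

Theorem theorem3p6 (D D' : unitRingType)
    (divD : division_ring D) (divD' : division_ring D')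
    (s : D -> D) (s' : D' -> D')
    (invs : ring_involution s) (invs' : ring_involution s')
    (R1 : restriction_R1 s) (R1' : restriction_R1 s')
    (R2 : restriction_R2 s) (R2' : restriction_R2 s')
    (n n' : nat) (n_ge2 : (2 <= n)%N) (n'_ge2 : (2 <= n')%N)
    (phi : hermitian_mx s n -> hermitian_mx s' n')
    (phi_surj : forall B, exists A, phi A = B)
    (phi_rank : forall A B : hermitian_mx s n,
        left_row_rank (val A - val B) = n <->
        left_row_rank (val (phi A) - val (phi B)) = n') :
  exists phi_inv : hermitian_mx s' n' -> hermitian_mx s n,
    [/\ cancel phi phi_inv, cancel phi_inv phi,
        preserves_adjacency phi, preserves_adjacency phi_inv
      & n = n'].
Proof.
(* If [A] and [B] have the same image, every [X] is opposite to both or to neither. *)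
have phi_inj A B : phi A = phi B -> A = B.
  move=> phiAB; apply: contrapT => AB.
  have [X XA XB] := opposite_separates divD invs R2 AB.
  by apply: XB; apply/phi_rank; rewrite -phiAB; apply/phi_rank.
pose psi B := sval (cid (phi_surj B)).
have psiK : cancel psi phi by move=> B; exact: svalP (cid (phi_surj B)).
have phiK : cancel phi psi by move=> A; apply: phi_inj; rewrite psiK.
have psi_rank A B : opposite A B <-> opposite (psi A) (psi B).
  by rewrite /opposite phi_rank !psiK.
have phi_adj : preserves_adjacency phi.
  exact: (opposite_preserving_adjacency divD divD' invs invs' R1 R1' R2 R2'
    phiK psiK phi_rank).
have psi_adj : preserves_adjacency psi.
  exact: (opposite_preserving_adjacency divD' divD invs' invs R1' R1 R2' R2
    psiK phiK psi_rank).
exists psi; split=> //; apply/eqP; rewrite eqn_leq; apply/andP; split.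
  apply: (adjacency_preserving_dim divD' divD invs' psi_adj) => A B.
  by move/psi_rank.
by apply: (adjacency_preserving_dim divD divD' invs phi_adj) => A B /phi_rank.
Qed.
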